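(* Let $G=(V,E)$ be a weighted graph, let $\Omega\subset V$ be a finite subset, and let $\Lambda$ be the Dirichlet-to-Neumann operator on $\Omega$. Then the multiplicity of the eigenvalue $0$ of $\Lambda$, i.e. $\dim\operatorname{Ker}\Lambda$, is equal to the number of connected components of the graph $\widetilde{\Omega}$.
   Context: $V$ is a countable set and $\mu:V\times V\to[0,\infty)$, $(x,y)\mapsto\mu_{xy}=\mu_{yx}$, is a symmetric weight function; $\{x,y\}\in E$ (written $x\sim y$) iff $\mu_{xy}>0$. Self-loops are allowed. For $\Omega_1,\Omega_2\subset V$, $E(\Omega_1,\Omega_2)=\{\{x,y\}\in E: x\in\Omega_1,\ y\in\Omega_2\}$. The vertex boundary of $\Omega$ is $\delta\Omega=\{x\in V\setminus\Omega: x\sim y\text{ for some }y\in\Omega\}$, and $\overline{\Omega}=\Omega\cup\delta\Omega$. The graph $\widetilde{\Omega}$ has vertex set $\overline{\Omega}$ and edge set $E(\Omega,\overline{\Omega})$. The measure $m:\overline{\Omega}\to(0,\infty)$ is $m_x=\sum_{y\in V,\,y\sim x}\mu_{xy}$ for $x\in\Omega$ and $m_x=\sum_{y\in\Omega,\,y\sim x}\mu_{xy}$ for $x\in\delta\Omega$. For $f:\overline{\Omega}\to\mathbb{R}$, the Laplacian is $\Delta f(x)=\frac1{m_x}\sum_{y\in V,\,y\sim x}\mu_{xy}(f(y)-f(x))$ for $x\in\Omega$, and the outward normal derivative is $\frac{\partial f}{\partial n}(z)=\frac1{m_z}\sum_{x\in\Omega,\,x\sim z}\mu_{zx}(f(z)-f(x))$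 for $z\in\delta\Omega$. For $\varphi:\delta\Omega\to\mathbb{R}$, $u_\varphi:\overline{\Omega}\to\mathbb{R}$ denotes the harmonic extension of $\varphi$, i.e. the unique function with $\Delta u_\varphi=0$ on $\Omega$ and $u_\varphi=\varphi$ on $\delta\Omega$. The Dirichlet-to-Neumann operator is $\Lambda:\mathbb{R}^{\delta\Omega}\to\mathbb{R}^{\delta\Omega}$, $\Lambda\varphi=\frac{\partial u_\varphi}{\partial n}$. *)

(* Defs.v *)
From HB Require Import structures.
From mathcomp Require Import all_boot all_order all_algebra.
From mathcomp Require Import finmap.
From mathcomp Require Import boolp classical_sets functions cardinality fsbigop.
From mathcomp Require Import reals.

Set Implicit Arguments.
Unset Strict Implicit.
Unset Printing Implicit Defensive.

Import Order.TTheory GRing.Theory Num.Theory.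
Local Open Scope classical_set_scope.
Local Open Scope ring_scope.

Record weighted_graph (R : realType) (V : countType) := WeightedGraph {
  weight :> V -> V -> R;
  weight_ge0 : forall x y, 0 <= weight x y;
  weight_sym : forall x y, weight x y = weight y x }.

Section DirichletToNeumann.
Variables (R : realType) (V : countType) (mu : weighted_graph R V).
Variable Omega : {fset V}.

Definition adj : rel V := fun x y => 0 < mu x y.

(* The formula for [laplacian] below must make sense for every real function
   on the closure of Omega, which forces each vertex of Omega to have finitely
   many neighbours: with infinitely many neighbours y of x, the choice
   f y = f x + 1 / mu x y makes the sum diverge. *)
Definition locally_finite_on : Prop :=
  forall x, x \in Omega -> finite_set [set y | adj x y].

(* [fset_set] returns the empty set on infinite sets; see [mem_boundary]. *)
Definition boundary : {fset V} :=
  fset_set [set x | x \notin Omega /\ exists2 y, y \in Omega & adj x y].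

Lemma mem_boundary x : locally_finite_on ->
  x \in boundary <-> x \notin Omega /\ exists2 y, y \in Omega & adj x y.
Proof.
move=> lf; rewrite /boundary in_fset_set ?in_setE//.
apply: (@sub_finite_set _ _ (\bigcup_(y in [set` Omega]) [set z | adj y z])).
  by move=> z [_ [y yO zy]]; exists y => //=; rewrite /adj weight_sym.
by apply: bigcup_finite => [|y yO]; [exact: finite_fset | exact: lf].
Qed.

Definition vclosure : {fset V} := (Omega `|` boundary)%fset.

Definition inner (x : Omega) : vclosure := fincl (fsubsetUl Omega boundary) x.
Definition outer (z : boundary) : vclosure := fincl (fsubsetUr Omega boundary) z.

Definition tilde_adj : rel vclosure := fun x y =>
  adj (val x) (val y) && ((val x \in Omega) || (val y \in Omega)).

Definition num_components : nat := n_comp tilde_adj predT.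

Definition vmeasure (x : vclosure) : R :=
  if val x \in Omega then \sum_(y \in [set y | adj (val x) y]) mu (val x) y
  else \sum_(y : Omega | adj (val x) (val y)) mu (val x) (val y).

(* All neighbours in V of a vertex of Omega lie in [vclosure], so summing over
   [vclosure] is summing over V. *)
Definition laplacian (f : {ffun vclosure -> R}) (x : Omega) : R :=
  (vmeasure (inner x))^-1 *
  \sum_(y : vclosure | adj (val x) (val y))
     mu (val x) (val y) * (f y - f (inner x)).

Definition normal_derivative (f : {ffun vclosure -> R}) (z : boundary) : R :=
  (vmeasure (outer z))^-1 *
  \sum_(x : Omega | adj (val x) (val z))
     mu (val z) (val x) * (f (outer z) - f (inner x)).

Definition is_harmonic_extension (phi : {ffun boundary -> R^o})
    (u : {ffun vclosure -> R}) : Prop :=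
  (forall x, laplacian u x = 0) /\ (forall z, u (outer z) = phi z).

Definition unique_harmonic_extensions : Prop :=
  forall phi, exists! u, is_harmonic_extension phi u.

Definition harmonic_extension (phi : {ffun boundary -> R^o}) :
    {ffun vclosure -> R} :=
  xget [ffun=> 0] [set u | is_harmonic_extension phi u].

Definition DtN_fun (phi : {ffun boundary -> R^o}) : {ffun boundary -> R^o} :=
  [ffun z => normal_derivative (harmonic_extension phi) z].

(* [linfun] returns an unrelated linear map when its argument is not linear;
   see [DtNE]. *)
Definition DtN : 'End({ffun boundary -> R^o}) := linfun DtN_fun.

Lemma harmonic_extensionP phi : unique_harmonic_extensions ->
  is_harmonic_extension phi (harmonic_extension phi).
Proof.
move=> wp; have [u [hu _]] := wp phi; rewrite /harmonic_extension.
by apply: (xgetPex _ (P := [set u | is_harmonic_extension phi u])); exists u.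
Qed.

Lemma laplacian_is_linear a (f g : {ffun vclosure -> R}) x :
  laplacian [ffun y => a * f y + g y] x = a * laplacian f x + laplacian g x.
Proof.
rewrite /laplacian mulrCA -mulrDr (mulr_sumr _ _ _ a) -big_split /=; congr (_ * _).
apply: eq_bigr => y _; rewrite !ffunE mulrCA -mulrDr; congr (_ * _).
by rewrite mulrBr opprD addrACA.
Qed.

Lemma normal_derivative_is_linear a (f g : {ffun vclosure -> R}) z :
  normal_derivative [ffun y => a * f y + g y] z =
  a * normal_derivative f z + normal_derivative g z.
Proof.
rewrite /normal_derivative mulrCA -mulrDr (mulr_sumr _ _ _ a) -big_split /=.
congr (_ * _); apply: eq_bigr => y _; rewrite !ffunE mulrCA -mulrDr.
by congr (_ * _); rewrite mulrBr opprD addrACA.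
Qed.

Lemma DtN_fun_linear : unique_harmonic_extensions -> linear DtN_fun.
Proof.
move=> wp a phi psi.
have [phiL phiB] := harmonic_extensionP phi wp.
have [psiL psiB] := harmonic_extensionP psi wp.
set u := harmonic_extension phi in phiL phiB.
set v := harmonic_extension psi in psiL psiB.
have extE : harmonic_extension (a *: phi + psi) = [ffun y => a * u y + v y].
  have [w [_ wu]] := wp (a *: phi + psi).
  rewrite -(wu _ (harmonic_extensionP _ wp)); apply: wu; split=> [x|z].
    by rewrite laplacian_is_linear phiL psiL mulr0 addr0.
  by rewrite !ffunE phiB psiB.
by apply/ffunP => z; rewrite !ffunE extE normal_derivative_is_linear.
Qed.

Lemma DtNE : unique_harmonic_extensions -> DtN =1 DtN_fun.
Proof.
move=> wp phi.
pose M := GRing.isLinear.Build _ _ _ _ DtN_fun (DtN_fun_linear wp).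
pose L : {linear {ffun boundary -> R^o} -> {ffun boundary -> R^o}} :=
  HB.pack DtN_fun M.
exact: (lfunE L phi).
Qed.

End DirichletToNeumann.

(* Main.v *)
Require Import Defs.
From HB Require Import structures.
From mathcomp Require Import all_boot all_order all_algebra.
From mathcomp Require Import finmap.
From mathcomp Require Import boolp classical_sets functions cardinality fsbigop.
From mathcomp Require Import reals.
From mathcomp Require Import ring.

Set Implicit Arguments.
Unset Strict Implicit.
Unset Printing Implicit Defensive.

Import Order.TTheory GRing.Theory Num.Theory.
Local Open Scope ring_scope.

(* A function u on the closure whose Laplacian and normal derivative both vanish
   has zero Dirichlet energy, so it is constant along the edges of the graph
   [tilde_adj]; the converse is immediate.  Hence the kernel of the operator is
   the image of the functions on the set of components under pull-back to the
   boundary, and this pull-back is injective by uniqueness of harmonic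
   extensions. *)

Lemma dirichlet_energy0 (R : realDomainType) (I : finType) (w : I -> I -> R)
    (u : I -> R) :
  (forall x y, 0 <= w x y) -> (forall x y, w x y = w y x) ->
  (forall x, \sum_y w x y * (u y - u x) = 0) ->
  forall x y, w x y != 0 -> u x = u y.
Proof.
move=> w_ge0 w_sym harm x y wxy.
(* Summation by parts: [(u i - u j) ^+ 2] is minus the sum of [(u j - u i) * u i] and its copy with
   [i] and [j] exchanged. The symmetry of [w] lets both double sums vanish by the hypothesis on
   rows. *)
have energy0 : \sum_i \sum_j w i j * (u i - u j) ^+ 2 = 0.
  have flux0 : \sum_i \sum_j w i j * (u j - u i) * u i = 0.
    by rewrite big1 // => i _; rewrite -mulr_suml harm mul0r.
  have flux0' : \sum_i \sum_j w i j * (u i - u j) * u j = 0.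
    rewrite exchange_big /= -[RHS]flux0.
    by apply: eq_bigr => i _; apply: eq_bigr => j _; rewrite w_sym.
  transitivity (- (\sum_i \sum_j w i j * (u j - u i) * u i
                   + \sum_i \sum_j w i j * (u i - u j) * u j)); last first.
    by rewrite flux0 flux0' addr0 oppr0.
  rewrite -big_split -sumrN; apply: eq_bigr => i _ /=.
  by rewrite -big_split -sumrN; apply: eq_bigr => j _ /=; ring.
have term_ge0 i j : 0 <= w i j * (u i - u j) ^+ 2 by rewrite mulr_ge0 ?sqr_ge0.
have row_ge0 i : 0 <= \sum_j w i j * (u i - u j) ^+ 2.
  by apply: sumr_ge0 => j _.
have /(_ x isT) row0 := psumr_eq0P (fun i _ => row_ge0 i) energy0.
have /(_ y isT)/eqP := psumr_eq0P (fun j _ => term_ge0 x j) row0.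
by rewrite mulf_eq0 (negPf wxy) sqrf_eq0 subr_eq0 => /eqP.
Qed.

Section TildeGraph.
Variables (R : realType) (V : countType) (mu : weighted_graph R V).
Variable Omega : {fset V}.
Hypothesis Omega_lf : locally_finite_on mu Omega.

Local Notation closure := (vclosure mu Omega).
Local Notation edge := (@tilde_adj R V mu Omega).

Lemma adj_sym : symmetric (adj mu).
Proof. by move=> x y; rewrite /adj weight_sym. Qed.

Lemma tilde_adj_sym : symmetric edge.
Proof. by move=> x y; rewrite /tilde_adj adj_sym orbC. Qed.

(** Weights between two boundary vertices are cut off, as such pairs are not edges of the graph. The
    value 0 off the edges lets every sum run over the whole closure. *)
Definition tilde_weight (x y : closure) : R :=
  if edge x y then mu (val x) (val y) else 0.

Lemma tilde_weight_ge0 x y : 0 <= tilde_weight x y.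
Proof. by rewrite /tilde_weight; case: ifP => // _; exact: weight_ge0. Qed.

Lemma tilde_weight_sym x y : tilde_weight x y = tilde_weight y x.
Proof. by rewrite /tilde_weight tilde_adj_sym weight_sym. Qed.

Lemma tilde_weight_neq0 x y : edge x y -> tilde_weight x y != 0.
Proof. by rewrite /tilde_weight => exy; rewrite exy gt_eqF //; case/andP: exy. Qed.

Lemma boundary_notin (z : boundary mu Omega) : val z \notin Omega.
Proof. by have [] := (mem_boundary _ Omega_lf).1 (valP z). Qed.

Variant vclosure_spec : closure -> Prop :=
  | VInner x : vclosure_spec (inner mu x)
  | VOuter z : vclosure_spec (@outer _ _ mu Omega z).

Lemma vclosureP x : vclosure_spec x.
Proof.
have := valP x; rewrite in_fsetU => /orP[xO|xB].
  have -> : x = inner mu [` xO]%fset by exact: val_inj.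
  by constructor.
have -> : x = @outer _ _ mu Omega [` xB]%fset by exact: val_inj.
by constructor.
Qed.

(** The unnormalized Laplacian of the graph [edge]. It treats interior and boundary vertices alike:
    up to the measure it is the Laplacian on the former and minus the normal derivative on the
    latter. *)
Definition flux (f : {ffun closure -> R}) (x : closure) : R :=
  \sum_y tilde_weight x y * (f y - f x).

Lemma laplacian_flux f x :
  laplacian f x = (vmeasure (inner mu x))^-1 * flux f (inner mu x).
Proof.
rewrite /laplacian big_mkcond; congr (_ * _); apply: eq_bigr => y _ /=.
rewrite /tilde_weight /tilde_adj /= (valP x) andbT.
by case: ifP => // _; rewrite mul0r.
Qed.

Lemma normal_derivative_flux f z :
  normal_derivative f z = - ((vmeasure (outer z))^-1 * flux f (outer z)).
Proof.
rewrite /normal_derivative -mulrN; congr (_ * _); rewrite /flux.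
transitivity (- \sum_(y | edge (outer z) y)
    mu (val z) (val y) * (f y - f (outer z))).
  (* Since [z] lies outside [Omega], any edge at [z] has its other end in [Omega], so [inner]
     reaches all terms of the sum. *)
  rewrite (reindex_omap (@inner _ _ mu Omega) (fun y => insub (val y))) => [|y]; last first.
    rewrite /tilde_adj /= (negPf (boundary_notin z)) /= => /andP[_ yO].
    by rewrite insubT /=; congr Some; exact: val_inj.
  rewrite -sumrN; apply: eq_big => [x|x _].
    rewrite /tilde_adj /= (valP x) orbT andbT adj_sym.
    by rewrite valK eqxx andbT.
  by rewrite -mulrN opprB.
congr (- _); rewrite big_mkcond; apply: eq_bigr => y _ /=.
by rewrite /tilde_weight; case: ifP => // _; rewrite mul0r.
Qed.

Lemma flux_edge_constant (f : {ffun closure -> R}) :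
  (forall x y, edge x y -> f x = f y) -> forall x, flux f x = 0.
Proof.
move=> f_const x; rewrite /flux big1 // => y _.
by rewrite /tilde_weight; case: ifP => [/f_const->|_]; rewrite ?subrr ?mulr0 ?mul0r.
Qed.

Lemma edge_constant_flux (f : {ffun closure -> R}) :
  (forall x, flux f x = 0) -> forall x y, edge x y -> f x = f y.
Proof.
move=> f0 x y /tilde_weight_neq0.
exact: (dirichlet_energy0 tilde_weight_ge0 tilde_weight_sym f0).
Qed.

Lemma edge_connect_sym : connect_sym edge.
Proof. exact/sym_connect_sym/tilde_adj_sym. Qed.

Lemma edge_constant_connect (T : Type) (f : closure -> T) :
  (forall x y, edge x y -> f x = f y) -> forall x y, connect edge x y -> f x = f y.
Proof.
move=> f_const x y /connectP[p + ->]; elim: p x => //= y' p IHp x.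
by case/andP => /f_const -> /IHp.
Qed.

(** A component is encoded by its canonical representative, so [val] is a section of
    [component_of]. *)
Definition component : finType := {x : closure | x \in roots edge}.

Definition component_of (x : closure) : component :=
  exist _ (fingraph.root edge x) (roots_root edge_connect_sym x).

Lemma component_of_edge x y : edge x y -> component_of x = component_of y.
Proof.
move=> exy; apply/val_inj/eqP => /=.
by rewrite (root_connect edge_connect_sym); exact: connect1.
Qed.

Lemma component_ofK c : component_of (val c) = c.
Proof. by apply: val_inj => /=; apply/eqP; exact: (valP c). Qed.

Lemma card_component : #|component| = num_components mu Omega.
Proof.
rewrite card_sig; apply: eq_card => x.
by rewrite !inE andbT.
Qed.

Hypothesis measure_gt0 : forall x : closure, 0 < vmeasure x.
Hypothesis Omega_wp : unique_harmonic_extensions mu Omega.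

Lemma vmeasure_inv_mul_eq0 (x : closure) (a : R) : (vmeasure x)^-1 * a = 0 -> a = 0.
Proof.
by move=> /eqP; rewrite mulf_eq0 invr_eq0 gt_eqF //= => /eqP.
Qed.

Definition component_lift (c : {ffun component -> R^o}) : {ffun closure -> R} :=
  [ffun x => c (component_of x)].

Definition component_trace (c : {ffun component -> R^o}) :
    {ffun boundary mu Omega -> R^o} :=
  [ffun z => c (component_of (outer z))].

Lemma component_trace_linear : linear component_trace.
Proof. by move=> a c d; apply/ffunP => z; rewrite !ffunE. Qed.

HB.instance Definition _ :=
  GRing.isLinear.Build _ _ _ _ component_trace component_trace_linear.

Lemma flux_component_lift c x : flux (component_lift c) x = 0.
Proof.
apply: flux_edge_constant => y z /component_of_edge yz.
by rewrite !ffunE yz.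
Qed.

(** The lift has zero flux, hence is harmonic, and its boundary values are the trace; uniqueness of
    the extension does the rest. *)
Lemma harmonic_component_lift c :
  harmonic_extension (component_trace c) = component_lift c.
Proof.
have [w [_ w_uniq]] := Omega_wp (component_trace c).
rewrite -(w_uniq _ (harmonic_extensionP _ Omega_wp)); apply: w_uniq.
split=> [x|z]; last by rewrite !ffunE.
by rewrite laplacian_flux flux_component_lift mulr0.
Qed.

(** The trace determines its harmonic extension, which is the lift, and the lift takes the value
    [c k] at the representative of [k], even if that vertex is interior. In effect, every component
    meets the boundary. *)
Lemma component_trace_inj : injective component_trace.
Proof.
move=> c d cd; apply/ffunP => k.
have /ffunP/(_ (val k)) : component_lift c = component_lift d.
  by rewrite -!harmonic_component_lift cd.
by rewrite !ffunE component_ofK.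
Qed.

Lemma DtN_component_trace c : DtN mu Omega (component_trace c) = 0.
Proof.
rewrite (DtNE Omega_wp); apply/ffunP => z; rewrite !ffunE.
rewrite normal_derivative_flux // harmonic_component_lift.
by rewrite flux_component_lift mulr0 oppr0.
Qed.

Lemma DtN_ker_component_trace phi :
  DtN mu Omega phi = 0 -> exists c, phi = component_trace c.
Proof.
rewrite (DtNE Omega_wp) => /ffunP Lphi0.
have [u_harm u_bdry] := harmonic_extensionP phi Omega_wp.
set u := harmonic_extension phi in u_harm u_bdry.
(* Harmonicity gives this in the interior, and the vanishing of the normal derivative gives it on
   the boundary. *)
have flux0 x : flux u x = 0.
  case: (vclosureP x) => [y|z].
    by have := u_harm y; rewrite laplacian_flux; exact: vmeasure_inv_mul_eq0.
  have /eqP := Lphi0 z; rewrite !ffunE normal_derivative_flux // oppr_eq0.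
  by move=> /eqP; exact: vmeasure_inv_mul_eq0.
(* The witness samples [u] rather than [phi], because the representative of a component may be
   interior. *)
exists [ffun k => u (val k)]; apply/ffunP => z; rewrite !ffunE -u_bdry.
apply: (edge_constant_connect (edge_constant_flux flux0)).
exact: connect_root.
Qed.

Lemma lker_DtN : lker (DtN mu Omega) = limg (linfun component_trace).
Proof.
apply/vspaceP => phi; apply/idP/idP.
  rewrite memv_ker => /eqP/DtN_ker_component_trace[c ->].
  by rewrite -(lfunE component_trace) memv_img ?memvf.
case/memv_imgP => c _ ->.
by rewrite memv_ker lfunE /= DtN_component_trace.
Qed.

End TildeGraph.

Theorem proposition3p2 (R : realType) (V : countType)
    (mu : weighted_graph R V) (Omega : {fset V})
    (Omega_lf : locally_finite_on mu Omega)
    (measure_gt0 : forall x : vclosure mu Omega, 0 < vmeasure x)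
    (Omega_wp : unique_harmonic_extensions mu Omega) :
  \dim (lker (DtN mu Omega)) = num_components mu Omega.
Proof.
(* The trace is injective, so its image has the dimension of the space of functions on
   components. *)
rewrite lker_DtN // limg_dim_eq.
  by rewrite dimvf /dim /= muln1 card_component.
apply/eqP; rewrite capfv; apply/lker0P => c d.
by rewrite !lfunE; exact: component_trace_inj.
Qed.
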